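(* Let $u(x)=|x|$ for $x\in[-1,1]$. Then for every integer $N>2$, $$\big|(u-\pi_N^Lu)(0)\big|\le\frac{2}{\pi(N-1)},\qquad \big|(u-\pi_N^Lu)(\pm1)\big|\le\frac{1}{2\sqrt\pi}\,\frac{\Gamma(N/2-1)}{\Gamma(N/2+1/2)}.$$
   Context: $P_n$ is the Legendre polynomial of degree $n$, $\hat u_n^L=\frac{2n+1}{2}\int_{-1}^1u(x)P_n(x)\,\mathrm dx$, and $\pi_N^Lu=\sum_{n=0}^N\hat u_n^LP_n$ is the $L^2(-1,1)$-orthogonal projection onto polynomials of degree at most $N$. *)

(* Defs.v *)
From HB Require Import structures.
From mathcomp Require Export all_boot all_order all_algebra.
From mathcomp Require Export all_classical all_reals all_analysis.

Set Implicit Arguments.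
Unset Strict Implicit.
Unset Printing Implicit Defensive.

Import Order.TTheory GRing.Theory Num.Theory.
Import numFieldNormedType.Exports.

Local Open Scope classical_set_scope.
Local Open Scope ring_scope.

(* Rodrigues' formula; normalised so that P_n(1) = 1. *)
Definition legendre (R : realType) (n : nat) : {poly R} :=
  (2 ^+ n * n`!%:R)^-1 *: (('X ^+ 2 - 1) ^+ n)^`(n).

Definition legendre_coef (R : realType) (u : R -> R) (n : nat) : R :=
  (2 * n%:R + 1) / 2 *
  \int[lebesgue_measure]_(x in `[-1, 1]) (u x * (legendre R n).[x]).

Definition legendre_proj (R : realType) (N : nat) (u : R -> R) : {poly R} :=
  \sum_(n < N.+1) legendre_coef u n *: legendre R n.

(* Euler's integral of the second kind; only meaningful for s > 0, where it
   converges. *)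
Definition Gamma (R : realType) (s : R) : R :=
  \int[lebesgue_measure]_(t in `]0, +oo[) (t `^ (s - 1) * expR (- t)).

(* Main.v *)
Require Import Defs.
From mathcomp Require Import all_boot all_order all_algebra.
From mathcomp Require Import all_classical all_reals all_analysis.
From mathcomp Require Import measurable_realfun ring lra.
Import Order.TTheory GRing.Theory Num.Theory.
Import numFieldNormedType.Exports.
Local Open Scope ring_scope.

Set Implicit Arguments.
Unset Strict Implicit.

(**
Write [W m = 'C(2m, m) / 4 ^ m] and [w = (X ^ 2 - 1) ^ n]. For [n >= 2] an
antiderivative of [x * w^`(n)] is [x * w^`(n-1) - w^`(n-2)], which vanishes at
[1] and [-1]; so the Legendre coefficients of [|x|] are read off [w^`(n-2)] at
[0]. They make the partial sums telescope: the projection of degree [2m] has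
value [1 - (-1) ^ m * W m / (2 (m + 1))] at [1] and [-1], and
[(2m + 1) / (2m + 2) * W m ^ 2] at [0].

Substituting [t = x ^ 2] gives [Gamma ((k + 1) / 2) = 2 M_k], where [M_k] is the
integral of [x ^ k * exp (- x ^ 2)] over the half-line. The moments [M_k] have
closed forms in terms of [W], and their log-convexity
[M_(k+1) ^ 2 <= M_k M_(k+2)] is the Wallis bound [pi * m * W m ^ 2 <= 1], from
which both estimates follow.
*)

(** * Derivatives at a multiple root *)

Section DerivAtRoot.
Variables (R : comNzRingType) (a : R).

(** The result is again a power of [X - a] times a cofactor, so an induction that generalises [q]
    can be iterated on it. *)
Lemma deriv_exp_XsubC_mul n (q : {poly R}) :
  (('X - a%:P) ^+ n.+1 * q)^`() =
  ('X - a%:P) ^+ n * (q *+ n.+1 + ('X - a%:P) * q^`()).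
Proof.
rewrite derivM deriv_exp derivXsubC mul1r exprSr [RHS]mulrDr.
by rewrite mulrnAl mulrnAr mulrA.
Qed.

(** Each derivative lowers the exponent by one and multiplies the cofactor's value at [a] by the old
    exponent; the derivative of the cofactor comes with a factor [X - a] and dies at [a]. *)
Lemma derivn_exp_XsubC_mul n (q : {poly R}) :
  ((('X - a%:P) ^+ n * q)^`(n)).[a] = n`!%:R * q.[a].
Proof.
elim: n q => [|n IHn] q; first by rewrite derivn0 expr0 !mul1r.
rewrite derivSn deriv_exp_XsubC_mul.
rewrite IHn hornerD hornerMn hornerM hornerXsubC subrr mul0r addr0.
by rewrite mulrnAr -mulrnAl -mulrnA mulnC -factS.
Qed.

Lemma derivn_exp_XsubC_mul_eq0 k n (q : {poly R}) : (k < n)%N ->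
  ((('X - a%:P) ^+ n * q)^`(k)).[a] = 0.
Proof.
elim: k n q => [|k IHk] [|n] q // lekn.
  by rewrite derivn0 exprS -mulrA hornerM hornerXsubC subrr mul0r.
rewrite derivSn deriv_exp_XsubC_mul.
exact: IHk.
Qed.

End DerivAtRoot.

Lemma horner0_derivn (R : nzRingType) (p : {poly R}) n :
  (p^`(n)).[0] = p`_n *+ n`!.
Proof. by rewrite horner_coef0 coef_derivn addn0 ffactnn. Qed.

(** * Factorisations and coefficients of [(X ^ 2 - 1) ^ n] *)

Section Sqr_sub1.
Variable R : comNzRingType.

Lemma sqr_sub1_expE1 n :
  ('X ^+ 2 - 1 : {poly R}) ^+ n = ('X - 1%:P) ^+ n * ('X + 1%:P) ^+ n.
Proof. by rewrite -exprMn -subr_sqr expr1n. Qed.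

Lemma sqr_sub1_expEN1 n :
  ('X ^+ 2 - 1 : {poly R}) ^+ n = ('X - (-1)%:P) ^+ n * ('X - 1%:P) ^+ n.
Proof. by rewrite sqr_sub1_expE1 mulrC polyCN opprK. Qed.

Lemma coef_sub1_exp n i :
  (('X - 1 : {poly R}) ^+ n)`_i = (-1) ^+ (n - i) *+ 'C(n, i).
Proof.
have N1 k : (-1 : {poly R}) ^+ k = ((-1) ^+ k)%:P by rewrite polyC_exp polyCN.
rewrite addrC exprDn coef_sum.
under eq_bigr => j _ do rewrite coefMn N1 coefCM coefXn.
(* For [n < i] the truncated exponent [n - i] does no harm: the binomial is zero. *)
have [lein|ltni] := leqP i n; last first.
  rewrite bin_small // mulr0n big1 // => j _.
  by rewrite gtn_eqF ?mulr0 ?mul0rn // (leq_trans (ltn_ord j)).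
rewrite (bigD1 (Ordinal (n := n.+1) (m := i) lein)) //= eqxx mulr1.
rewrite big1 ?addr0 // => j ji; rewrite [_ == _]negbTE ?mulr0 ?mul0rn //.
by apply: contra ji => /eqP ij; apply/eqP/val_inj.
Qed.

Lemma sqr_sub1_exp_comp n :
  ('X ^+ 2 - 1 : {poly R}) ^+ n = (('X - 1) ^+ n) \Po 'X ^+ 2.
Proof. by rewrite rmorphXn /= comp_polyB comp_polyX comp_polyC. Qed.

Lemma coef_sqr_sub1_exp_double n i :
  (('X ^+ 2 - 1 : {poly R}) ^+ n)`_i.*2 = (-1) ^+ (n - i) *+ 'C(n, i).
Proof.
rewrite sqr_sub1_exp_comp coef_comp_poly_Xn // -muln2 dvdn_mull // mulnK //.
exact: coef_sub1_exp.
Qed.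

Lemma coef_sqr_sub1_exp_odd n i :
  (('X ^+ 2 - 1 : {poly R}) ^+ n)`_i.*2.+1 = 0.
Proof.
by rewrite sqr_sub1_exp_comp coef_comp_poly_Xn // dvdn2 /= odd_double.
Qed.

End Sqr_sub1.

(** * Values of Legendre polynomials at [1], [-1] and [0] *)

Section LegendreValues.
Variable R : realType.

Lemma legendre1 n : (legendre R n).[1] = 1.
Proof.
rewrite /legendre hornerZ sqr_sub1_expE1 derivn_exp_XsubC_mul.
rewrite horner_exp hornerD hornerX hornerC mulrC mulrAC mulrC mulrA.
by rewrite divff // mulf_neq0 // ?expf_neq0 // pnatr_eq0 // -lt0n fact_gt0.
Qed.

Lemma legendreN1 n : (legendre R n).[-1] = (-1) ^+ n.
Proof.
rewrite /legendre hornerZ sqr_sub1_expEN1 derivn_exp_XsubC_mul.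
have N2 : (-1 - 1 : R) = -1 * 2 by ring.
rewrite horner_exp hornerXsubC N2 exprMn.
by field; rewrite !(expf_neq0, pnatr_eq0) -?lt0n ?fact_gt0.
Qed.

(** The Wallis product of [(2i - 1) / (2i)] for [1 <= i <= m]; also the absolute value of [P_(2m)]
    at [0]. *)
Definition wallis m : R := 'C(m.*2, m)%:R / 4 ^+ m.

Lemma wallis0 : wallis 0 = 1.
Proof. by rewrite /wallis bin0 divr1. Qed.

Lemma wallisS m : wallis m.+1 = wallis m * ((2 * m%:R + 1) / (2 * m%:R + 2)).
Proof.
(* Two absorption identities, passing through ['C(2m + 1, m)], in a division-free form that holds in
   the naturals. *)
have E : (m.+1 * (m.+1 * 'C(m.+1.*2, m.+1)) = m.*2.+2 * (m.*2.+1 * 'C(m.*2, m)))%N.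
  rewrite doubleS -mul_bin_diag /= (mul_bin_down m.*2.+1).
  by rewrite -addnn -addSn addnK mulnCA.
have {}E : (m%:R + 1) * ((m%:R + 1) * 'C(m.+1.*2, m.+1)%:R) =
    (2 * m%:R + 2) * ((2 * m%:R + 1) * 'C(m.*2, m)%:R) :> R.
  by rewrite -!natrM -natrD addn2 !natr1 mul2n -!natrM E.
rewrite /wallis exprS.
have m0 : (m%:R + 1 : R) != 0 by rewrite natr1 pnatr_eq0.
have m2 : (2 * m%:R + 2 : R) != 0 by rewrite -natrM -natrD pnatr_eq0 addn2.
have p4 : (4 : R) ^+ m != 0 by rewrite expf_neq0 // pnatr_eq0.
have -> : 'C(m.+1.*2, m.+1)%:R = (2 * m%:R + 2) * ((2 * m%:R + 1) *
    'C(m.*2, m)%:R) / (m%:R + 1) ^+ 2 :> R.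
  by rewrite -E expr2; field.
by field; rewrite m0 m2 p4.
Qed.

Lemma legendre0_even m : (legendre R m.*2).[0] = (-1) ^+ m * wallis m.
Proof.
rewrite /legendre hornerZ horner0_derivn coef_sqr_sub1_exp_double.
have -> : (m.*2 - m = m)%N by rewrite -addnn addnK.
rewrite /wallis.
rewrite -[_ *+ _`!]mulr_natr -[_ *+ 'C(_, _)]mulr_natr -{1}mul2n exprM.
have -> : (2 : R) ^+ 2 = 4 by ring.
by field; rewrite !(expf_neq0, pnatr_eq0) -?lt0n ?fact_gt0.
Qed.

End LegendreValues.

(** * Integrals of polynomials, alone and against the weight [|x|] *)

Section PolyIntegral.
Variable R : realType.
Notation mu := (@lebesgue_measure R).

Lemma Rintegral_deriv_poly (p : {poly R}) (a b : R) : a < b ->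
  \int[mu]_(x in `[a, b]) (p^`()).[x] = p.[b] - p.[a].
Proof.
move=> ab; rewrite /Rintegral (@continuous_FTC2 _ _ (horner p)) //.
- by apply/continuous_subspaceT => x; exact: continuous_horner.
- split=> [x _| |]; first exact: derivable_horner.
  + by apply: cvg_at_right_filter; exact: continuous_horner.
  + by apply: cvg_at_left_filter; exact: continuous_horner.
- by move=> x _; rewrite derivE.
Qed.

(** On [[-1, 0]] the weight is [-x], so [-F] is the antiderivative there; the two halves contribute
    [F(1) - F(0)] and [F(-1) - F(0)]. *)
Lemma Rintegral_abs_mul_poly (p F : {poly R}) : F^`() = 'X * p ->
  \int[mu]_(x in `[-1, 1]) (`|x| * p.[x]) = F.[1] + F.[-1] - F.[0] *+ 2.
Proof.
move=> dF.
have cont : continuous (fun x : R => `|x| * p.[x]).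
  by move=> x; apply: cvgM; [exact: norm_continuous|exact: continuous_horner].
have integ (a b : R) : mu.-integrable `[a, b] (EFin \o (fun x : R => `|x| * p.[x])).
  apply: continuous_compact_integrable; first exact: segment_compact.
  exact: continuous_subspaceT.
have := @Rintegral_itvB R (fun x => `|x| * p.[x]) (BLeft (-1)) (BRight 1) 0
  (integ _ _).
rewrite !bnd_simp lerN10 ler01 => /(_ isT isT) /eqP.
rewrite subr_eq => /eqP ->; rewrite Rintegral_itv_obnd_cbnd; last first.
  by apply: integrableS (integ 0 1) => //; exact: subset_itv_oc_cc.
rewrite (@eq_Rintegral _ _ _ mu _ (fun x => (F^`()).[x])); last first.
  move=> x /[!inE] /= /[!in_itv] /= /andP[x0 _].
  by rewrite dF hornerM hornerX ger0_norm.
rewrite [X in _ + X](@eq_Rintegral _ _ _ mu _ (fun x => ((- F)^`()).[x])); last first.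
  move=> x /[!inE] /= /[!in_itv] /= /andP[_ x0].
  by rewrite derivN dF hornerN hornerM hornerX ler0_norm // mulNr.
rewrite !Rintegral_deriv_poly ?ltrN10 ?ltr01 // !hornerN mulr2n.
by ring.
Qed.
End PolyIntegral.

(** * Legendre coefficients and partial sums of [|x|] *)

Section LegendreAbs.
Variables (R : realType) (u : R -> R).
Hypothesis hu : forall x : R, -1 <= x <= 1 -> u x = `|x|.

Lemma legendre_coef_abs n (F : {poly R}) : F^`() = 'X * legendre R n ->
  legendre_coef u n =
  (2 * n%:R + 1) / 2 * (F.[1] + F.[-1] - F.[0] *+ 2).
Proof.
move=> dF; rewrite /legendre_coef -(Rintegral_abs_mul_poly dF).
congr (_ * _); apply: eq_Rintegral => x /[!inE] /= /[!in_itv] /= x11.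
by rewrite hu.
Qed.

(** Degrees [0] and [1] have no derivative of order [n - 2] to use, so the antiderivatives
    [x ^ 2 / 2] and [x ^ 3 / 3] are given by hand. *)
Lemma legendre_coef_abs0 : legendre_coef u 0 = 1 / 2.
Proof.
rewrite (@legendre_coef_abs 0 (2^-1 *: 'X ^+ 2)).
  by rewrite !hornerZ !hornerXn; field.
rewrite /legendre derivn0 !expr0 fact0 mulr1 invr1 scale1r mulr1.
by rewrite derivZ derivXn /= -scalerMnr scalerMnl -mulr_natr mulVf ?pnatr_eq0 // scale1r.
Qed.

Lemma legendre_coef_abs1 : legendre_coef u 1 = 0.
Proof.
rewrite (@legendre_coef_abs 1 (3^-1 *: 'X ^+ 3)).
  by rewrite !hornerZ !hornerXn; field.
rewrite /legendre derivn1 !expr1 mulr1 derivB derivXn derivC subr0 /=.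
rewrite derivZ derivXn /= -!scalerMnr !scalerMnl.
by rewrite -[3^-1 *+ 3]mulr_natr -[2^-1 *+ 2]mulr_natr !mulVf ?pnatr_eq0 // !scale1r.
Qed.

Lemma legendre_coef_abs_ge2 n : legendre_coef u n.+2 =
  (2 * n.+2%:R + 1) / (2 ^+ n.+2 * n.+2`!%:R) *
  ((('X ^+ 2 - 1) ^+ n.+2)`_n *+ n`!).
Proof.
set w : {poly R} := ('X ^+ 2 - 1) ^+ n.+2; set c := 2 ^+ _ * _.
rewrite (@legendre_coef_abs _ (c^-1 *: ('X * w^`(n.+1) - w^`(n)))); last first.
  rewrite derivZ derivB derivM derivX mul1r -!derivnS /legendre -/w -/c.
  by rewrite addrAC subrr add0r -scalerAr.
(* [1] and [-1] are roots of [w] of order [n + 2], so the antiderivative vanishes there; the factor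
   [2] on its value at [0] cancels the [1 / 2] of the coefficient. *)
have w1 k : (k < n.+2)%N -> (w^`(k)).[1] = 0.
  by move=> kn; rewrite /w sqr_sub1_expE1 derivn_exp_XsubC_mul_eq0.
have wN1 k : (k < n.+2)%N -> (w^`(k)).[-1] = 0.
  by move=> kn; rewrite /w sqr_sub1_expEN1 derivn_exp_XsubC_mul_eq0.
rewrite !hornerZ !hornerD !hornerM !hornerN !hornerX !w1 ?wN1 ?wN1 //.
rewrite mul0r (horner0_derivn w n); move: (_ *+ n`!) => t.
have c0 : c != 0 by rewrite mulf_neq0 ?expf_neq0 ?pnatr_eq0 // -lt0n fact_gt0.
by field.
Qed.

Lemma legendre_coef_abs_odd m : legendre_coef u m.*2.+1 = 0.
Proof.
case: m => [|m]; first exact: legendre_coef_abs1.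
by rewrite doubleS legendre_coef_abs_ge2 coef_sqr_sub1_exp_odd mul0rn mulr0.
Qed.

Lemma legendre_coef_abs_even m : legendre_coef u m.*2 =
  (-1) ^+ m.+1 * (4 * m%:R + 1) * wallis R m /
  (2 * (m%:R + 1) * (2 * m%:R - 1)).
Proof.
(* At [m = 0] the factor [2m - 1] is [-1] and cancels the sign [(-1) ^ (m + 1)], so the formula also
   covers degree [0]. *)
case: m => [|m]; first by rewrite legendre_coef_abs0 wallis0; field.
rewrite doubleS legendre_coef_abs_ge2 coef_sqr_sub1_exp_double.
have -> : (m.*2.+2 - m = m.+2)%N by rewrite -addnn -!addSn addnK.
(* Moves the binomial one place, to the central one that defines [wallis]. *)
have E : (m.+2 * 'C(m.*2.+2, m) = m.+1 * 'C(m.*2.+2, m.+1))%N.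
  by rewrite (mul_bin_left _ m) -addnn -!addSn addnK.
have {}E : 'C(m.*2.+2, m)%:R =
    (m%:R + 1) * 'C(m.*2.+2, m.+1)%:R / (m%:R + 2) :> R.
  have m2 : (m%:R + 2 : R) != 0 by rewrite -natrD pnatr_eq0 addn2.
  apply: (mulIf m2); rewrite divfK // natr1 -natrD addn2 -!natrM.
  by rewrite mulnC E.
rewrite -[_ *+ _`!]mulr_natr -[_ *+ 'C(_, _)]mulr_natr E.
rewrite !factS !natrM /wallis doubleS -[in 2 ^+ _]doubleS -[in 2 ^+ _]mul2n exprM.
have -> : (2 : R) ^+ 2 = 4 by ring.
have e1 : m.*2.+1%:R = 2 * m%:R + 1 :> R by rewrite -natr1 -mul2n natrM.
have e2 : m.*2.+2%:R = 2 * m%:R + 2 :> R by rewrite -addn2 natrD -mul2n natrM.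
have e3 : m.+1%:R = m%:R + 1 :> R by rewrite -natr1.
rewrite e1 e2 e3 [(-1) ^+ m.+2]exprSr.
have m0 := ler0n R m.
field; rewrite !(expf_neq0, pnatr_eq0) -?lt0n ?fact_gt0 //=.
by repeat (apply/andP; split); rewrite // lt0r_neq0 //; lra.
Qed.

(** The odd coefficients vanish, so raising the degree by two adds a single term; the telescoping
    sums are inductions on this form. *)
Lemma legendre_proj_abs_double m x : (legendre_proj m.*2 u).[x] =
  \sum_(k < m.+1) legendre_coef u k.*2 * (legendre R k.*2).[x].
Proof.
rewrite /legendre_proj horner_sum.
elim: m => [|m IHm]; first by rewrite !big_ord1 hornerZ.
rewrite doubleS 2!big_ord_recr /= IHm legendre_coef_abs_odd scale0r horner0.
by rewrite addr0 hornerZ [RHS]big_ord_recr.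
Qed.

Lemma legendre_proj_abs_doubleS m : legendre_proj m.*2.+1 u = legendre_proj m.*2 u.
Proof.
by rewrite /legendre_proj big_ord_recr /= legendre_coef_abs_odd scale0r addr0.
Qed.

Lemma legendre_proj_abs_at1 m :
  (legendre_proj m.*2 u).[1] = 1 - (-1) ^+ m * wallis R m / (2 * (m%:R + 1)).
Proof.
rewrite legendre_proj_abs_double; elim: m => [|m IHm].
  by rewrite big_ord1 legendre1 legendre_coef_abs0 wallis0; field.
rewrite big_ord_recr /= IHm legendre1 legendre_coef_abs_even wallisS.
have m0 := ler0n R m; rewrite -!natr1 !exprS.
by field; rewrite !lt0r_neq0 //; lra.
Qed.

Lemma legendre_proj_abs_atN1 m :
  (legendre_proj m.*2 u).[-1] = (legendre_proj m.*2 u).[1].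
Proof.
rewrite !legendre_proj_abs_double; apply: eq_bigr => k _.
by rewrite legendre1 legendreN1 -mul2n exprM sqrrN !expr1n.
Qed.

Lemma legendre_proj_abs_at0 m : (legendre_proj m.*2 u).[0] =
  (2 * m%:R + 1) / (2 * m%:R + 2) * wallis R m ^+ 2.
Proof.
rewrite legendre_proj_abs_double; elim: m => [|m IHm].
  by rewrite big_ord1 legendre0_even legendre_coef_abs0 wallis0; field.
rewrite big_ord_recr /= IHm legendre0_even legendre_coef_abs_even wallisS.
have m0 := ler0n R m; rewrite -!natr1 [(-1) ^+ m.+2]exprS.
(* The coefficient and the value at [0] have opposite signs; [field] needs the square of the sign to
   simplify their product. *)
have /eqP N1 : ((-1) ^+ m.+1) ^+ 2 == 1 :> R by rewrite sqrr_sign.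
field: N1; rewrite !lt0r_neq0 //; lra.
Qed.

End LegendreAbs.

(** * Exhausting the open half-line by compact intervals *)

Section Exhaustion.
Local Open Scope classical_set_scope.
Variable R : realType.
Notation mu := (@lebesgue_measure R).

(** The exponent is a parameter because squaring maps the interval for [p = 1] onto the one for
    [p = 2], which matches the two sides of the substitution [t = x ^ 2]. *)
Lemma itv0y_bigcup (p : nat) : (0 < p)%N ->
  \bigcup_n `[(n.+1%:R ^- p : R), n.+1%:R ^+ p] = `]0, +oo[.
Proof.
move=> p0; apply/seteqP; split => x /=.
  move=> [n _] /=; rewrite !in_itv /= andbT => /andP[+ _].
  by apply: lt_le_trans; rewrite invr_gt0 exprn_gt0.
rewrite in_itv /= andbT => x0.
have xV0 : 0 < x^-1 by rewrite invr_gt0.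
(* Bounding the sum bounds [x] and its inverse at once by [n + 1], hence by its [p]-th power. *)
pose n := Num.truncn (x + x^-1).
have n1 : x + x^-1 < n.+1%:R by exact: truncnS_gt.
have np : n.+1%:R <= n.+1%:R ^+ p :> R by rewrite ler_eXnr // ler1n.
exists n => //=; rewrite in_itv /= (le_trans _ np) ?andbT; last by lra.
rewrite -[leRHS]invrK lef_pV2 ?posrE ?exprn_gt0 ?invr_gt0 //.
by rewrite (le_trans _ np) //; lra.
Qed.

Lemma ge0_cvgn_integral_itv0y (p : nat) (f : R -> R) : (0 < p)%N ->
  measurable_fun `](0 : R), +oo[ f -> (forall x, 0 < x -> 0 <= f x) ->
  (\int[mu]_(x in `[(n.+1%:R ^- p)%R, (n.+1%:R ^+ p)%R]) (f x)%:E)%E @[n --> \oo]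
    --> (\int[mu]_(x in `]0%R, +oo[) (f x)%:E)%E.
Proof.
move=> p0 mf f0; rewrite -(itv0y_bigcup p0).
have sub n : `[(n.+1%:R ^- p : R), n.+1%:R ^+ p] `<=` `]0, +oo[.
  by move=> x xn; rewrite -(itv0y_bigcup p0); exists n.
apply: ge0_nondecreasing_set_cvg_integral => //.
- move=> m n mn; apply/subsetPset => x /=; rewrite !in_itv /= => /andP[x1 x2].
  have mnp : m.+1%:R ^+ p <= n.+1%:R ^+ p :> R.
    by rewrite lerXn2r ?nnegrE // ler_nat.
  rewrite (le_trans x2) // andbT (le_trans _ x1) //.
  by rewrite lef_pV2 ?posrE ?exprn_gt0.
- by move=> n; apply/measurable_EFinP; exact: measurable_funS (sub n) mf.
- by move=> n x /sub /=; rewrite in_itv /= andbT lee_fin; exact: f0.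
Qed.

End Exhaustion.

Lemma derivable_oo_LRcontinuousT (R : realType) (F : R -> R) (a b : R) :
  (forall x, derivable F x 1) -> derivable_oo_LRcontinuous F a b.
Proof.
move=> dF; have cF : continuous F.
  by move=> x; apply/differentiable_continuous/derivable1_diffP.
split=> [x _||]; first exact: dF.
  by apply: cvg_at_right_filter; exact: cF.
by apply: cvg_at_left_filter; exact: cF.
Qed.

(** * Gaussian moments: recurrence and first values *)

Section GaussMoments.
Local Open Scope classical_set_scope.
Variable R : realType.
Notation mu := (@lebesgue_measure R).

Definition monomial_gauss k (x : R) := x ^+ k * gauss_fun x.

Lemma continuous_monomial_gauss k : continuous (monomial_gauss k).
Proof.
by move=> x; apply: cvgM; [exact: exprn_continuous|exact: continuous_gauss_fun].
Qed.

Lemma measurable_monomial_gauss k (D : set R) : measurable D ->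
  measurable_fun D (monomial_gauss k).
Proof.
move=> mD; apply: measurable_funTS.
exact: continuous_measurable_fun (@continuous_monomial_gauss k).
Qed.

Lemma monomial_gauss_ge0 k x : 0 <= x -> 0 <= monomial_gauss k x.
Proof. by move=> x0; rewrite mulr_ge0 ?exprn_ge0 ?gauss_fun_ge0. Qed.

Lemma is_derive_gauss (x : R) :
  is_derive x 1 (fun y : R => - (gauss_fun y / 2)) (x * gauss_fun x).
Proof.
rewrite /gauss_fun; apply: is_derive_eq.
by rewrite /GRing.scale /=; field.
Qed.

(** This kills the boundary term of the integration by parts in the limit. *)
Lemma cvg_monomial_gauss k :
  monomial_gauss k n.+1%:R @[n --> \oo] --> (0 : R).
Proof.
(* With [y = n + 1], the exponential series gives [exp (y ^ 2) >= (y ^ 2) ^ (k + 1) / (k + 1)!],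
   which is at least [y ^ (k + 1) / (k + 1)!] as [y >= 1]. *)
have bound (n : nat) :
    monomial_gauss k n.+1%:R <= (k.+1)`!%:R / n.+1%:R.
  have n1 : 1 <= n.+1%:R :> R by rewrite ler1n.
  have n0 : 0 < n.+1%:R :> R by rewrite ltr0n.
  have f0 : 0 < (k.+1)`!%:R :> R by rewrite ltr0n fact_gt0.
  have := @expR_ge1Dxn R (n.+1%:R ^+ 2) k (exprn_ge0 2 (ltW n0)).
  have : n.+1%:R ^+ k.+1 / (k.+1)`!%:R <=
      (n.+1%:R ^+ 2) ^+ k.+1 / (k.+1)`!%:R :> R.
    rewrite ler_pM2r ?invr_gt0 // lerXn2r ?nnegrE ?exprn_ge0 ?(ltW n0) //.
    by rewrite expr2 ler_peMl ?(ltW n0).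
  move=> le1 le2.
  rewrite /monomial_gauss /gauss_fun expRN ler_pdivrMr ?expR_gt0 // mulrAC.
  rewrite ler_pdivlMr // -exprSr mulrC -ler_pdivrMr //; lra.
apply: (@squeeze_cvgr _ _ _ R (fun=> 0) (fun n => (k.+1)`!%:R / n.+1%:R)).
- by near=> n; rewrite bound andbT; exact: monomial_gauss_ge0.
- exact: cvg_cst.
- rewrite -[X in _ --> X](mulr0 (k.+1)`!%:R); apply: cvgM; first exact: cvg_cst.
  exact: cvg_harmonic.
Unshelve. all: by end_near. Qed.

Lemma integrable_monomial_gauss_itv k (a b : R) :
  mu.-integrable `[a, b] (EFin \o monomial_gauss k).
Proof.
apply: continuous_compact_integrable; first exact: segment_compact.
exact/continuous_subspaceT/continuous_monomial_gauss.
Qed.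

(** Integration by parts with [x ^ (k + 1)] and [- exp (- x ^ 2) / 2], on a bounded interval where
    continuity gives integrability. *)
Lemma Rintegral_monomial_gauss_itvSS k (b : R) : 0 < b ->
  \int[mu]_(x in `[0, b]) monomial_gauss k.+2 x =
  k.+1%:R / 2 * \int[mu]_(x in `[0, b]) monomial_gauss k x -
  monomial_gauss k.+1 b / 2.
Proof.
move=> b0.
have -> : \int[mu]_(x in `[0, b]) monomial_gauss k.+2 x =
    \int[mu]_(x in `[0, b]) (x ^+ k.+1 * (x * gauss_fun x)).
  by apply: eq_Rintegral => x _; rewrite /monomial_gauss exprSr mulrA.
rewrite (@Rintegration_by_parts R (fun x => x ^+ k.+1)
  (fun x => - (gauss_fun x / 2)) (fun x => k.+1%:R * x ^+ k)) //.
- rewrite (@eq_Rintegral _ _ _ mu _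
    (fun x => - (k.+1%:R / 2) * monomial_gauss k x)); last first.
    by move=> x _; rewrite /monomial_gauss; field.
  rewrite RintegralZl //; last exact: integrable_monomial_gauss_itv.
  by rewrite /monomial_gauss expr0n /=; field.
- apply: continuous_subspaceT => x.
  by apply: cvgM; [exact: cvg_cst|exact: exprn_continuous].
- by apply: derivable_oo_LRcontinuousT => x; exact: exprn_derivable.
- by move=> x _; rewrite exp_derive1 /GRing.scale /=.
- apply: continuous_subspaceT => x.
  by apply: cvgM; [exact: cvg_id|exact: continuous_gauss_fun].
- apply: derivable_oo_LRcontinuousT => x.
  by have [] := is_derive_gauss x.
- by move=> x _; rewrite derive1E; have [_ ->] := is_derive_gauss x.
Qed.

Lemma ge0_cvgn_integral_itvcy (f : R -> R) :
  measurable_fun setT f -> (forall x, 0 <= x -> 0 <= f x) ->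
  (\int[mu]_(x in `[0%R, n.+1%:R]) (f x)%:E)%E @[n --> \oo]
    --> (\int[mu]_(x in `[0%R, +oo[) (f x)%:E)%E.
Proof.
move=> mf f0.
(* [f] may be negative left of [0], as odd monomials are; composing with the absolute value makes it
   nonnegative everywhere and keeps it on the half-line. *)
pose fn (x : R) := f `|x|.
have mfn : measurable_fun [set: R] fn.
  by apply: (measurableT_comp mf); exact: normr_measurable.
have fn0 x : 0 <= fn x by rewrite /fn f0.
have := @ge0_cvgn_integral R mu _ fn0 mfn; rewrite -cvg_shiftS.
have -> : (\int[mu]_(x in `[0%R, +oo[) (fn x)%:E)%E =
    (\int[mu]_(x in `[0%R, +oo[) (f x)%:E)%E.
  apply: eq_integral => x /[!inE] /=; rewrite in_itv /= andbT => x0.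
  by rewrite /fn ger0_norm.
suff -> : (fun n => (\int[mu]_(x in `[0%R, n.+1%:R]) (fn x)%:E)%E) =
    (fun n => (\int[mu]_(x in `[0%R, n.+1%:R]) (f x)%:E)%E) by [].
apply/funext => n; apply: eq_integral => x /[!inE] /=.
by rewrite in_itv /= => /andP[x0 _]; rewrite /fn ger0_norm.
Qed.

(** Limit of the recurrence on [[0, n + 1]]. Taking a finite value [l] as premise lets finiteness
    and value propagate together. *)
Lemma integral_monomial_gaussSS k (l : R) :
  (\int[mu]_(x in `[0%R, +oo[) (monomial_gauss k x)%:E)%E = l%:E ->
  (\int[mu]_(x in `[0%R, +oo[) (monomial_gauss k.+2 x)%:E)%E =
  (k.+1%:R / 2 * l)%:E.
Proof.
move=> kl.
have fin j (n : nat) :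
    (\int[mu]_(x in `[0%R, n.+1%:R]) (monomial_gauss j x)%:E)%E =
    (\int[mu]_(x in `[0%R, n.+1%:R]) monomial_gauss j x)%R%:E.
  rewrite /Rintegral fineK //; apply: integrable_fin_num => //.
  exact: integrable_monomial_gauss_itv.
have cvgj j := @ge0_cvgn_integral_itvcy (monomial_gauss j)
  (measurable_monomial_gauss j measurableT) (@monomial_gauss_ge0 j).
have ck : (\int[mu]_(x in `[0%R, n.+1%:R]) monomial_gauss k x)%R @[n --> \oo] --> l.
  have := cvgj k; rewrite kl; under eq_fun do rewrite fin.
  by move/fine_cvg.
have ckSS : (\int[mu]_(x in `[0%R, n.+1%:R]) monomial_gauss k.+2 x)%R @[n --> \oo]
    --> k.+1%:R / 2 * l.
  under eq_fun do rewrite Rintegral_monomial_gauss_itvSS ?ltr0n //.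
  have -> : k.+1%:R / 2 * l = k.+1%:R / 2 * l - 0 / 2 by rewrite mul0r subr0.
  apply: cvgB; first by apply: cvgM; [exact: cvg_cst|].
  by apply: cvgM; [exact: cvg_monomial_gauss|exact: cvg_cst].
have ckSSE : (\int[mu]_(x in `[0%R, n.+1%:R]) (monomial_gauss k.+2 x)%:E)%E
    @[n --> \oo] --> (k.+1%:R / 2 * l)%:E.
  under eq_fun do rewrite fin.
  by apply: cvg_EFin; [exact: nearW|exact: ckSS].
exact: (cvg_unique (@ereal_hausdorff R) (cvgj k.+2) ckSSE).
Qed.

Lemma integral_monomial_gauss0 :
  (\int[mu]_(x in `[0%R, +oo[) (monomial_gauss 0 x)%:E)%E = (Num.sqrt pi / 2)%:E.
Proof.
by rewrite -integral0y_gauss; apply: eq_integral => x _; rewrite /monomial_gauss mul1r.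
Qed.

Lemma integral_monomial_gauss1 :
  (\int[mu]_(x in `[0%R, +oo[) (monomial_gauss 1 x)%:E)%E = (1 / 2)%:E.
Proof.
rewrite (@ge0_continuous_FTC2y _ _ (fun x => - (gauss_fun x / 2)) 0 0).
- by rewrite /gauss_fun expr0n /= oppr0 expR0 -EFinB sub0r opprK.
- exact: monomial_gauss_ge0.
- exact/continuous_subspaceT/continuous_monomial_gauss.
- rewrite -oppr0 -[X in - X](mul0r 2^-1); apply: cvgN.
  by apply: cvgM; [exact: cvg_gauss_fun|exact: cvg_cst].
- by move=> x _; have [] := is_derive_gauss x.
- apply: cvg_at_right_filter; apply: cvgN.
  by apply: cvgM; [exact: continuous_gauss_fun|exact: cvg_cst].
- move=> x _; rewrite derive1E; have [_ ->] := is_derive_gauss x.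
  by rewrite /monomial_gauss expr1.
Qed.

End GaussMoments.

(** * Closed forms of the moments, the Wallis bound and Gamma at half-integers *)

Section MomentValues.
Local Open Scope classical_set_scope.
Variable R : realType.
Notation mu := (@lebesgue_measure R).

Definition gauss_moment k : R := \int[mu]_(x in `[0, +oo[) monomial_gauss k x.

(** Certifies that [gauss_moment] is a true integral and not the default value [0] of a divergent
    one. *)
Lemma integral_gauss_moment k :
  (\int[mu]_(x in `[0%R, +oo[) (monomial_gauss k x)%:E)%E = (gauss_moment k)%:E.
Proof.
rewrite /gauss_moment /Rintegral fineK //.
(* The recurrence advances by two, so the induction carries two consecutive moments. *)
suff [[l ->]] : (exists l : R,
      (\int[mu]_(x in `[0%R, +oo[) (monomial_gauss k x)%:E)%E = l%:E) /\
    (exists l : R,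
      (\int[mu]_(x in `[0%R, +oo[) (monomial_gauss k.+1 x)%:E)%E = l%:E) by [].
elim: k => [|k [[l kl] IHk]].
  by split; eexists; [exact: integral_monomial_gauss0|exact: integral_monomial_gauss1].
by split=> //; eexists; exact: integral_monomial_gaussSS kl.
Qed.

Lemma gauss_moment0 : gauss_moment 0 = Num.sqrt pi / 2.
Proof. by rewrite /gauss_moment /Rintegral integral_monomial_gauss0. Qed.

Lemma gauss_moment1 : gauss_moment 1 = 1 / 2.
Proof. by rewrite /gauss_moment /Rintegral integral_monomial_gauss1. Qed.

Lemma gauss_momentSS k : gauss_moment k.+2 = k.+1%:R / 2 * gauss_moment k.
Proof.
by have /integral_monomial_gaussSS := integral_gauss_moment k;
  rewrite integral_gauss_moment => -[].
Qed.

Lemma integrable_monomial_gauss k :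
  mu.-integrable `[0%R, +oo[ (EFin \o monomial_gauss k).
Proof.
apply/integrableP; split.
  by apply/measurable_EFinP; exact: measurable_monomial_gauss.
rewrite integral_fin_num_abs //; last exact: measurable_monomial_gauss.
by rewrite integral_gauss_moment.
Qed.

Lemma gauss_moment_even m :
  gauss_moment m.*2 = Num.sqrt pi / 2 * wallis R m * m`!%:R.
Proof.
elim: m => [|m IHm]; first by rewrite gauss_moment0 wallis0 !mulr1.
rewrite doubleS gauss_momentSS IHm wallisS factS natrM -!natr1 -mul2n natrM.
have m0 := ler0n R m.
by field; rewrite lt0r_neq0 //; lra.
Qed.

Lemma gauss_moment_odd m : gauss_moment m.*2.+1 = m`!%:R / 2.
Proof.
elim: m => [|m IHm]; first by rewrite gauss_moment1.
by rewrite doubleS gauss_momentSS IHm factS natrM -!natr1 -mul2n natrM; field.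
Qed.

Lemma wallis_gt0 m : 0 < wallis R m.
Proof. by rewrite divr_gt0 ?exprn_gt0 // ltr0n bin_gt0 -addnn leq_addr. Qed.

Lemma gauss_moment_gt0 k : 0 < gauss_moment k.
Proof.
rewrite -(odd_double_half k); case: (odd k).
  by rewrite add1n gauss_moment_odd divr_gt0 // ltr0n fact_gt0.
rewrite add0n gauss_moment_even.
apply: mulr_gt0; last by rewrite ltr0n fact_gt0.
by rewrite mulr_gt0 ?wallis_gt0 // divr_gt0 // sqrtr_gt0 pi_gt0.
Qed.

(* Integrate [x ^+ k * (x - t) ^+ 2 >= 0] and optimise over [t]. *)
Lemma gauss_moment_log_convex k :
  gauss_moment k.+1 ^+ 2 <= gauss_moment k * gauss_moment k.+2.
Proof.
have le t : 2 * t * gauss_moment k.+1 <=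
    gauss_moment k.+2 + t ^+ 2 * gauss_moment k.
  have int0 := @integrable_monomial_gauss.
  have intZ j c : mu.-integrable `[0%R, +oo[
      (EFin \o (fun x => c * monomial_gauss j x)).
    exact: (integrableZl _ c (int0 j)).
  rewrite /gauss_moment -!RintegralZl // -RintegralD //.
  apply: le_Rintegral => //; first exact: (integrableD _ (int0 _) (intZ _ _)).
  move=> x /=; rewrite in_itv /= andbT => x0.
  rewrite -subr_ge0 (_ : _ - _ = monomial_gauss k x * (x - t) ^+ 2).
    by rewrite mulr_ge0 ?sqr_ge0 ?monomial_gauss_ge0.
  by rewrite /monomial_gauss !exprS; ring.
have k0 := gauss_moment_gt0 k.
have := le (gauss_moment k.+1 / gauss_moment k).
rewrite -(ler_pM2l k0).
have -> : gauss_moment k * (2 * (gauss_moment k.+1 / gauss_moment k) *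
    gauss_moment k.+1) = 2 * gauss_moment k.+1 ^+ 2.
  by field; rewrite lt0r_neq0.
have -> : gauss_moment k * (gauss_moment k.+2 +
    (gauss_moment k.+1 / gauss_moment k) ^+ 2 * gauss_moment k) =
    gauss_moment k * gauss_moment k.+2 + gauss_moment k.+1 ^+ 2.
  by field; rewrite lt0r_neq0.
by lra.
Qed.

(** Log-convexity around an even moment: its square contains [pi * W ^ 2], while its odd neighbours
    involve factorials only. *)
Lemma wallis_le m : pi * wallis R m ^+ 2 * m%:R <= 1.
Proof.
case: m => [|m]; first by rewrite mulr0.
have := gauss_moment_log_convex m.*2.+1.
rewrite -[m.*2.+3]/(m.+1.*2.+1) -[m.*2.+2]/(m.+1.*2).
rewrite gauss_moment_even !gauss_moment_odd factS natrM.
have sp : Num.sqrt pi ^+ 2 = pi :> R by rewrite sqr_sqrtr ?pi_ge0.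
have f0 : 0 < m`!%:R :> R by rewrite ltr0n fact_gt0.
have m0 : 0 < m.+1%:R :> R by rewrite ltr0n.
(* [c] is the product of the two odd moments; the square of the even one is [c] times the quantity
   to bound. *)
move: (wallis R m.+1) => W h; pose c : R := m`!%:R ^+ 2 * m.+1%:R / 4.
have c0 : 0 < c by rewrite divr_gt0 // mulr_gt0 // exprn_gt0.
rewrite -(ler_pM2r c0) mul1r -sp.
by apply: le_trans (le_trans _ h) _; rewrite le_eqVlt; apply/orP; left; apply/eqP;
  rewrite /c; field.
Qed.

(** For [k = 0] the integrand of [Gamma] is singular at [0], so the substitution is made on compact
    intervals inside the open half-line and both sides pass to the limit. *)
Lemma Gamma_gauss_moment k : Gamma ((k%:R + 1) / 2) = 2 * gauss_moment k.
Proof.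
rewrite /Gamma /Rintegral; set s : R := _ - 1.
pose G (t : R) := t `^ s * expR (- t).
have cG (t : R) : 0 < t -> {for t, continuous G}.
  move=> t0.
  have cp : {for t, continuous (fun x : R => x `^ s)}.
    apply/differentiable_continuous/derivable1_diffP.
    by apply: derivable_powR; rewrite in_itv /= t0.
  apply: cvgM; first exact: cp.
  by apply: (@continuous_comp _ _ _ -%R expR);
    [exact: opp_continuous|exact: continuous_expR].
have mG : measurable_fun `](0 : R), +oo[ G.
  apply: open_continuous_measurable_fun => //.
  by move=> t; rewrite inE /= in_itv /= andbT; exact: cG.
have G0 t : 0 < t -> 0 <= G t by move=> _; rewrite mulr_ge0 ?powR_ge0 ?expR_ge0.
have mM : measurable_fun `](0 : R), +oo[ (fun x => 2 * monomial_gauss k x).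
  by apply: measurable_funM => //; exact: measurable_monomial_gauss.
have M0 (x : R) : 0 < x -> 0 <= 2 * monomial_gauss k x.
  by move=> x0; rewrite mulr_ge0 // monomial_gauss_ge0 // ltW.
have cvg2 := @ge0_cvgn_integral_itv0y R 2 G isT mG G0.
have cvg1 := @ge0_cvgn_integral_itv0y R 1 _ isT mM M0.
suff E : (\int[mu]_(x in `]0%R, +oo[) (G x)%:E)%E =
    (\int[mu]_(x in `]0%R, +oo[) (2 * monomial_gauss k x)%:E)%E.
  rewrite E; under eq_integral do rewrite EFinM.
  rewrite ge0_integralZl //=; last 2 first.
  - by apply/measurable_EFinP; exact: measurable_monomial_gauss.
  - move=> x; rewrite in_itv /= andbT => x0.
    by rewrite lee_fin monomial_gauss_ge0 // ltW.
  rewrite integral_itv_obnd_cbnd ?integral_gauss_moment //.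
  by apply/measurable_EFinP; exact: measurable_monomial_gauss.
apply: (cvg_unique (@ereal_hausdorff R) cvg2).
suff -> : (fun n => \int[mu]_(x in `[(n.+1%:R ^- 2)%R, (n.+1%:R ^+ 2)%R]) (G x)%:E)%E =
  (fun n => \int[mu]_(x in `[(n.+1%:R ^- 1)%R, (n.+1%:R ^+ 1)%R])
     (2 * monomial_gauss k x)%:E)%E by exact: cvg1.
apply/funext => n; rewrite !expr1.
have n1 : 1 <= n.+1%:R :> R by rewrite ler1n.
have nV0 : 0 < n.+1%:R^-1 :> R by rewrite invr_gt0 ltr0n.
have nV1 : n.+1%:R^-1 <= 1 :> R by rewrite invf_le1 // ltr0n.
have dsqr : (fun x : R => x ^+ 2)^`() = (fun x => 2 * x).
  by apply/funext => x; rewrite exp_derive1 /= expr1.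
have c2 : continuous (fun x : R => 2 * x).
  by move=> x; apply: cvgM; [exact: cvg_cst|exact: cvg_id].
have := @integration_by_substitution_increasing R (fun x => x ^+ 2) G
  n.+1%:R^-1 n.+1%:R.
rewrite exprVn => ->.
- apply: eq_integral => x /[!inE] /=; rewrite in_itv /= => /andP[xn _].
  have x0 : 0 < x by exact: lt_le_trans xn.
  congr (_%:E); rewrite fctE /= dsqr /G /monomial_gauss /gauss_fun.
  (* Here [2 * s = k - 1]; the Jacobian [2 * x] then restores [2 * x ^ k]. *)
  have -> : (x ^+ 2) `^ s = x `^ (k%:R - 1).
    rewrite -powR_mulrn ?ltW // -powRrM; congr (_ `^ _).
    by rewrite /s; field.
  rewrite powRB ?(lt0r_neq0 x0) ?implybT // powRr1 ?ltW // powR_mulrn ?ltW //.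
  by field; rewrite lt0r_neq0.
- exact: le_trans n1.
- move=> x y; rewrite !in_itv /= => /andP[xn _] _ xy.
  have x0 : 0 <= x by rewrite ltW // (lt_le_trans nV0).
  by rewrite ltrXn2r.
- by rewrite dsqr => x _; exact: c2.
- by rewrite dsqr; apply/cvg_ex; eexists; apply: cvg_at_right_filter; exact: c2.
- by rewrite dsqr; apply/cvg_ex; eexists; apply: cvg_at_left_filter; exact: c2.
- by apply: derivable_oo_LRcontinuousT => x; exact: exprn_derivable.
- apply: continuous_in_subspaceT => t; rewrite inE /= in_itv /= => /andP[tn _].
  by apply: cG; apply: lt_le_trans tn; rewrite invr_gt0 exprn_gt0 ?ltr0n.
Qed.

End MomentValues.

(** * The error estimates at [0], [1] and [-1] *)

Unset Implicit Arguments.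

Theorem theorem3 (R : realType) (u : R -> R)
  (hu : forall x : R, -1 <= x <= 1 -> u x = `|x|)
  (N : nat) (hN : (2 < N)%N) :
  let err (x : R) := `|u x - (legendre_proj N u).[x]| in
  let endpoint_bound :=
    1 / (2 * Num.sqrt pi)
      * (Gamma (N%:R / 2 - 1) / Gamma (N%:R / 2 + 1 / 2)) in
  [/\ err 0 <= 2 / (pi * (N%:R - 1)),
      err 1 <= endpoint_bound
    & err (-1) <= endpoint_bound].
Proof.
move=> err bnd.
have pi0 := pi_gt0 R.
have sp0 : 0 < Num.sqrt pi :> R by rewrite sqrtr_gt0.
(* [N / 2 - 1] is [((N - 3) + 1) / 2], and [2 < N] makes the natural subtraction exact. *)
have bndE : bnd = gauss_moment R (N - 3) / (2 * Num.sqrt pi * gauss_moment R N).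
  rewrite /bnd (_ : N%:R / 2 - 1 = ((N - 3)%:R + 1) / 2); last first.
    by rewrite natrB //; field.
  rewrite (_ : N%:R / 2 + 1 / 2 = (N%:R + 1) / 2); last by field.
  rewrite !Gamma_gauss_moment; field.
  by rewrite !lt0r_neq0 // gauss_moment_gt0.
pose m := N./2.
have m1 : (1 <= m)%N by rewrite /m; case: N hN {err bnd bndE} @m => [|[|[|N]]].
have m1R : 1 <= m%:R :> R by rewrite ler1n.
have projE : legendre_proj N u = legendre_proj m.*2 u.
  rewrite -{1}(odd_double_half N) -/m; case: (odd N) => //.
  by rewrite add1n legendre_proj_abs_doubleS.
have err1 : err 1 = wallis R m / (2 * (m%:R + 1)).
  rewrite /err hu; last by apply/andP; split; lra.
  rewrite normr1 projE legendre_proj_abs_at1 // opprB addrCA subrr addr0.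
  rewrite -mulrA normrM normrX normrN1 expr1n mul1r ger0_norm //.
  by rewrite divr_ge0 ?ltW ?wallis_gt0 //; lra.
have errN1 : err (-1) = err 1.
  rewrite /err !hu; [|by apply/andP; split; lra..].
  by rewrite normrN1 normr1 projE legendre_proj_abs_atN1.
have W0 := wallis_gt0 R m.
have Wle := wallis_le R m.
have le1 : err 1 <= bnd.
  rewrite err1 bndE.
  have : N = (odd N + m.*2)%N by rewrite odd_double_half.
  move: m1 m1R W0 Wle {projE err1}; case: (odd N) => + + + + EN.
    (* Odd [N = 2p + 3]: the bound is exactly [W p / (2 (p + 1))], and the error
       [W (p + 1) / (2 (p + 2))] is smaller factor by factor. *)
    case: m EN => // p -> _ _ _ _; rewrite add1n doubleS !subSS subn0.
    rewrite gauss_moment_even -doubleS gauss_moment_odd factS natrM wallisS -[p.+1%:R]natr1.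
    have p0 := ler0n R p; have Wp := wallis_gt0 R p.
    have f0 : 0 < p`!%:R :> R by rewrite ltr0n fact_gt0.
    have -> : Num.sqrt pi / 2 * wallis R p * p`!%:R /
        (2 * Num.sqrt pi * ((p%:R + 1) * p`!%:R / 2)) =
        wallis R p / (2 * (p%:R + 1)).
      by field; rewrite !lt0r_neq0 //; lra.
    rewrite ler_pM ?invr_ge0 ?mulr_ge0 ?divr_ge0 ?(ltW Wp) //; try lra.
      by rewrite ler_piMr ?(ltW Wp) // ler_pdivrMr; lra.
    by rewrite lef_pV2 ?posrE; lra.
  (* Even [N = 2p + 4], since [m = 1] would give [N = 2]. The bound is now an inverse multiple of
     [W], so comparing it with the error brings in [pi * W ^ 2]. *)
  case: m EN => [|[|p]]; [by []|by move=> EN; rewrite EN in hN|].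
  move=> -> _ _ W0 Wle; rewrite add0n !doubleS !subSS subn0.
  rewrite gauss_moment_odd -!doubleS gauss_moment_even.
  move: (wallis R p.+2) W0 Wle => W W0.
  rewrite !factS !natrM -[p.+2%:R]natr1 -[p.+1%:R]natr1 => Wle.
  have p0 := ler0n R p.
  have f0 : 0 < p`!%:R :> R by rewrite ltr0n fact_gt0.
  have sp : Num.sqrt pi ^+ 2 = pi :> R by rewrite sqr_sqrtr ?ltW.
  have -> : p`!%:R / 2 / (2 * Num.sqrt pi *
      (Num.sqrt pi / 2 * W * ((p%:R + 1 + 1) * ((p%:R + 1) * p`!%:R)))) =
      (2 * Num.sqrt pi ^+ 2 * W * (p%:R + 2) * (p%:R + 1))^-1.
    by field; rewrite !lt0r_neq0 //; lra.
  rewrite sp -[leRHS]mul1r ler_pdivlMr; last first.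
    by rewrite !mulr_gt0 //; lra.
  rewrite mulrAC ler_pdivrMr; last by lra.
  (* The Wallis bound at [p + 2] reduces the claim to [2 (p + 1) <= 2 (p + 3)]. *)
  rewrite (_ : W * _ = (pi * W ^+ 2 * (p%:R + 1 + 1)) * (2 * (p%:R + 1))); last by ring.
  apply: (le_trans (ler_wpM2r _ Wle)); lra.
split=> //; last by rewrite errN1.
rewrite /err hu; last by rewrite lerN10 ler01.
rewrite normr0 sub0r normrN projE legendre_proj_abs_at0 //.
have Wsq : wallis R m ^+ 2 <= (pi * m%:R)^-1.
  by rewrite -[leRHS]mul1r ler_pdivlMr ?mulr_gt0 //; lra.
(* [N - 1 <= 2m] for either parity, which turns [1 / (pi * m)] into the bound
   [2 / (pi * (N - 1))]. *)
have N2m : N%:R <= 2 * m%:R + 1 :> R.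
  rewrite -natrM mul2n natr1 ler_nat -{1}(odd_double_half N) -add1n leq_add2r.
  exact: leq_b1.
have N3 : 3 <= N%:R :> R by rewrite ler_nat.
rewrite ger0_norm; last by rewrite mulr_ge0 ?sqr_ge0 // divr_ge0; lra.
have frac : (2 * m%:R + 1) / (2 * m%:R + 2) <= 1 :> R.
  by rewrite ler_pdivrMr; lra.
apply: (le_trans (ler_wpM2r (sqr_ge0 _) frac)); rewrite mul1r.
apply: (le_trans Wsq).
rewrite ler_pdivlMr; last by rewrite mulr_gt0 //; lra.
rewrite mulrC ler_pdivrMr; last by rewrite mulr_gt0 //; lra.
by rewrite mulrCA ler_pM2l //; lra.
Qed.
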